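(* There is a wRK-complete $\mathbf{\Pi}^1_1$ ideal on $\omega$; that is, there is a $\mathbf{\Pi}^1_1$ ideal $\mathcal J$ on $\omega$ such that $\mathcal I \leq_{\rm wRK} \mathcal J$ for every $\mathbf{\Pi}^1_1$ ideal $\mathcal I$ on $\omega$.
   Context: The power set $\mathcal P(\omega)$ is identified with the Cantor space $2^\omega$ via characteristic functions. An ideal on $\omega$ is a nonempty family $\mathcal I$ of subsets of $\omega$ such that for all $x,y\subseteq\omega$: $x,y\in\mathcal I \implies x\cup y\in\mathcal I$, and $y\subseteq x\in\mathcal I \implies y\in\mathcal I$. (An ideal need not contain all finite sets and may equal $2^\omega$.) An ideal is called $\mathbf{\Pi}^1_1$ if it is a (boldface) $\mathbf{\Pi}^1_1$, i.e. co-analytic, subset of $2^\omega$. For ideals $\mathcal I,\mathcal J$ on $\omega$, $\mathcal I\leq_{\rm wRK}\mathcal J$ (weak Rudin-Keisler reducibility) means that there are an infinite set $A\subseteq\omega$ and a function $f:A\to\omega$ such that for each $x\subseteq\omega$, $x\in\mathcal I \iff f^{-1}[x]\in\mathcal J$, where $f^{-1}[x]=\{a\in A: f(a)\in x\}$. If $\mathcal C$ is a family of ideals and $\mathcal J\in\mathcal C$ satisfies $\mathcal I\leq_{\rm wRK}\mathcal J$ for each $\mathcal I\in\mathcal C$, then $\mathcal J$ is called a wRK-complete $\mathcal C$ ideal. *)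

(* Defs.v *)
From HB Require Import structures.
From mathcomp Require Import all_boot all_order all_algebra.
From mathcomp Require Import all_classical all_reals topology cantor.

Set Implicit Arguments.
Unset Strict Implicit.
Unset Printing Implicit Defensive.

Local Open Scope classical_set_scope.

(* {ptws _ -> _} selects the product topology; the bare arrow type may carry
   the topology of uniform convergence instead. *)
Notation baire_space := {ptws nat -> nat}.

(* Boldface Sigma^1_1 in the form "exists y in omega^omega, closed", meaningful
   for X Polish. *)
Definition Sigma11 (X : topologicalType) (S : set X) : Prop :=
  exists2 C : set (X * baire_space)%type, closed C & S = fst @` C.

Definition Pi11 (X : topologicalType) (S : set X) : Prop := Sigma11 (~` S).

(* The subset of 2^omega corresponding to a family of subsets of omega, each
   subset being identified with its characteristic function. *)
Definition cantor_set (F : set (set nat)) : set cantor_space :=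
  [set a : cantor_space | F [set n | a n]].

Definition ideal_on_omega (I : set (set nat)) : Prop :=
  [/\ I !=set0,
      forall x y, I x -> I y -> I (x `|` y)
    & forall x y, y `<=` x -> I x -> I y].

Definition Pi11_ideal (I : set (set nat)) : Prop :=
  ideal_on_omega I /\ Pi11 (cantor_set I).

(* The partial function A -> omega is given by a total f whose values outside A
   are irrelevant. *)
Definition wRK_le (I J : set (set nat)) : Prop :=
  exists (A : set nat) (f : nat -> nat), infinite_set A /\
    forall x : set nat, I x <-> J (A `&` f @^-1` x).

Definition wRK_complete (C : set (set (set nat))) (J : set (set nat)) : Prop :=
  C J /\ forall I, C I -> wRK_le I J.

(* Main.v *)
Require Import Defs.
From mathcomp Require Import all_boot all_classical.
From mathcomp Require Import topology cantor.

(** A code [c : 2^omega] assigns to each [x] a tree [branching c x], and every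
    co-analytic family has the form {x : branching c x is well-founded}.  From
    an arbitrary code we extract a co-analytic ideal which is the coded family
    whenever that family is an ideal.  To a relation [r] associate the tree
    [defect c r] of attempts at a counterexample below [r]: sets x, y whose
    trees map into [r] (so their ranks are bounded by that of [r]), a subset z
    of their union, and an infinite branch of the tree of z.  The extracted
    ideal consists of the x such that all iterates of [defect c], applied to
    the tree of x, are well-founded.  If z is included in the union of x and y,
    and the tree of y maps into that of x, then the tree of z maps into the
    first iterate for x, hence the n-th iterate for z maps into the (n+1)-st
    for x; as well-founded trees are comparable by rank, this gives closure
    under unions.  If the coded family is an ideal there are no
    counterexamples, and the iterates are automatically well-founded.

    The extracted ideals are glued along the branches of the binary tree, the
    reduction for a code [c] living on the branch [c].  Each n labels
    infinitely many levels and only the labels occurring infinitely often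
    matter: this makes the finite interferences between distinct branches
    invisible, even for ideals not containing all finite sets. *)

Set Implicit Arguments.
Unset Strict Implicit.
Unset Printing Implicit Defensive.

Local Open Scope classical_set_scope.

(** * Coded trees, their branches and homomorphisms *)

(** Turns a branch of finite approximations into the infinite object approximated, both for [defect]
    and for coded trees. *)
Lemma chain_limit T (x0 : T) (w : nat -> seq T) :
    (forall m, size (w m) < size (w m.+1)) ->
    (forall m, w m = take (size (w m)) (w m.+1)) ->
  exists d : nat -> T, forall m i, i < size (w m) -> nth x0 (w m) i = d i.
Proof.
move=> ltw takew.
have lew m n : m <= n -> size (w m) <= size (w n).
  move=> mn; apply: (@homo_leq _ (size \o w) leq) mn => // [k i j|i].
    exact: leq_trans.
  exact: ltnW (ltw i).
have gew m : m <= size (w m) by elim: m => // m /leq_ltn_trans; apply.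
have nthw m n i : m <= n -> i < size (w m) -> nth x0 (w n) i = nth x0 (w m) i.
  move=> + im; elim: n => [|n IHn]; first by rewrite leqn0 => /eqP ->.
  rewrite leq_eqVlt => /orP[/eqP -> // | mn].
  by rewrite -(IHn mn) (takew n) nth_take // (leq_trans im) // lew.
exists (fun i => nth x0 (w i.+1) i) => m i im.
rewrite -(@nthw m (maxn m i.+1)) ?leq_maxl //.
by rewrite (@nthw i.+1) ?leq_maxr.
Qed.

Lemma code_cons_gt v s : CodeSeq.code s < CodeSeq.code (v :: s).
Proof.
by apply: leq_trans (leq_pmull _ _); rewrite ?expn_gt0 // ltnS -addnn leq_addr.
Qed.

Definition parent (i : nat) : nat := CodeSeq.code (behead (CodeSeq.decode i)).

(** [c] is consulted only about the first [i] bits of [x], so that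
    [branching c x] depends continuously on [x]; each node [i] has at most one
    parent, which the construction of homomorphisms by recursion needs. *)
Definition branching (c x : nat -> bool) (i j : nat) : bool :=
  [&& j < i, j == parent i & c (pickle (mkseq x i, i))].

Definition illfounded (r : nat -> nat -> bool) : Prop :=
  exists u : nat -> nat, forall m, r (u m.+1) (u m).

Definition hom (r s : nat -> nat -> bool) : Prop :=
  exists p : nat -> nat, forall i j, r i j -> s (p i) (p j).

Lemma hom_refl r : hom r r.
Proof. by exists id. Qed.

Lemma hom_illfounded r s : hom r s -> illfounded r -> illfounded s.
Proof. by move=> [p rp] [u ru]; exists (p \o u) => m; exact: rp. Qed.

Lemma eq_branching c x x' i j :
  (forall k, k < i -> x k = x' k) -> branching c x i j = branching c x' i j.
Proof.
move=> xx'; rewrite /branching; suff -> : mkseq x i = mkseq x' i by [].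
by apply/eq_in_map => k; rewrite mem_iota => /xx'.
Qed.

(** * The tree of attempts at a counterexample *)

(** The values at one argument of the sets x, y, z and of the maps p, q from
    the trees of x and y to a given relation. *)
Definition entry : Type := ((bool * bool * bool) * (nat * nat))%type.
Definition entry0 : entry := ((false, false, false), (0, 0)).

Definition entry_x (e : entry) : bool := e.1.1.1.
Definition entry_y (e : entry) : bool := e.1.1.2.
Definition entry_z (e : entry) : bool := e.1.2.
Definition entry_p (e : entry) : nat := e.2.1.
Definition entry_q (e : entry) : nat := e.2.2.

Definition attempt_code : seq entry -> nat := pickle.
Definition attempt : nat -> option (seq entry) := unpickle.

Lemma attempt_codeK w : attempt (attempt_code w) = Some w.
Proof. exact: pickleK. Qed.

(** Parents are smaller than children, so the bound [b < n] covers every edge from [n], and only the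
    values of [d] up to [n] are consulted. *)
Definition valid_at c (r : nat -> nat -> bool) (d : nat -> entry) (n : nat) : bool :=
  [&& entry_z (d n) ==> entry_x (d n) || entry_y (d n),
      all (fun b => branching c (entry_x \o d) n b ==>
             r (entry_p (d n)) (entry_p (d b))) (iota 0 n)
    & all (fun b => branching c (entry_y \o d) n b ==>
             r (entry_q (d n)) (entry_q (d b))) (iota 0 n)].

(** An attempt of length [i] also stands for the node [i] of the tree of z: a
    step lengthens the attempt and descends in that tree. *)
Definition defect c (r : nat -> nat -> bool) (k' k : nat) : bool :=
  match attempt k', attempt k with
  | Some w', Some w =>
    [&& w == take (size w) w',
        branching c (entry_z \o nth entry0 w') (size w') (size w)
      & all (valid_at c r (nth entry0 w')) (iota 0 (size w'))]
  | _, _ => false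
  end.

Lemma eq_valid_at c r d d' n :
  (forall k, k <= n -> d k = d' k) -> valid_at c r d n = valid_at c r d' n.
Proof.
move=> dd'; rewrite /valid_at dd' //; congr [&& _, _ & _].
  apply/eq_in_all => b; rewrite mem_iota /= add0n => bn.
  rewrite (@eq_branching _ (entry_x \o d) (entry_x \o d')) => [|k kn].
    by rewrite dd' // ltnW.
  by rewrite /= dd' // ltnW.
apply/eq_in_all => b; rewrite mem_iota /= add0n => bn.
rewrite (@eq_branching _ (entry_y \o d) (entry_y \o d')) => [|k kn].
  by rewrite dd' // ltnW.
by rewrite /= dd' // ltnW.
Qed.

Lemma take_mkseq T (f : nat -> T) i j : j <= i -> take j (mkseq f i) = mkseq f j.
Proof. by move=> ji; rewrite /mkseq -map_take take_iota (minn_idPl ji). Qed.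

(** Node [i] goes to the true data cut at length [i], an attempt that never fails. *)
Lemma hom_defect c r (x y z : nat -> bool) :
    (forall n, z n -> x n || y n) ->
  hom (branching c x) r -> hom (branching c y) r ->
  hom (branching c z) (defect c r).
Proof.
move=> zxy [p xp] [q yq]; pose d n : entry := ((x n, y n, z n), (p n, q n)).
exists (fun i => attempt_code (mkseq d i)) => i j zij.
have ji : j < i by case/andP: zij.
rewrite /defect !attempt_codeK !size_mkseq take_mkseq 1?ltnW // eqxx /=.
apply/andP; split.
  rewrite (@eq_branching _ _ z) // => k ki.
  by rewrite /= nth_mkseq.
apply/allP => n; rewrite mem_iota /= add0n => ni.
rewrite (@eq_valid_at _ _ _ d) => [|k kn]; last first.
  by rewrite nth_mkseq // (leq_ltn_trans kn).
apply/and3P; split.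
- by apply/implyP => /zxy.
- by apply/allP => b _; apply/implyP => /xp.
- by apply/allP => b _; apply/implyP => /yq.
Qed.

Lemma defect_hom c r s : hom r s -> hom (defect c r) (defect c s).
Proof.
move=> [h rh]; pose H (e : entry) : entry := (e.1, (h (entry_p e), h (entry_q e))).
exists (fun k => attempt_code (map H (odflt [::] (attempt k)))) => k' k.
rewrite /defect.
case: (attempt k') => // w'; case: (attempt k) => // w; rewrite /odflt /oapp.
rewrite !attempt_codeK !size_map => /and3P[/eqP ww' zw vw'].
rewrite -map_take -ww' eqxx /=; apply/andP; split.
  rewrite -(@eq_branching _ (entry_z \o nth entry0 w')) // => i iw'.
  by rewrite /= (nth_map entry0).
apply/allP => n n_w'; have := allP vw' n n_w'.
move: n_w'; rewrite mem_iota /= add0n => nw'.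
rewrite (@eq_valid_at _ s _ (H \o nth entry0 w')) => [|i iln]; last first.
  by rewrite (nth_map entry0) // (leq_ltn_trans iln).
move=> /and3P[zxy /allP xp /allP yq]; apply/and3P; split => //.
- by apply/allP => b /xp /implyP xb; apply/implyP => /xb /rh.
- by apply/allP => b /yq /implyP yb; apply/implyP => /yb /rh.
Qed.

(** The attempts along a branch cohere, and each validity test, being finite, passes to their
    limit. *)
Lemma defect_illfounded c r : illfounded (defect c r) ->
  exists x y z : nat -> bool, [/\ forall n, z n -> x n || y n, hom (branching c x) r,
    hom (branching c y) r & illfounded (branching c z)].
Proof.
move=> [u du].
have /choice[w uw] m : exists w : seq entry, attempt (u m) = Some w.
  have := du m; rewrite /defect; case: attempt => //.
  by case: attempt => // v; exists v.
have {}du m := du m; rewrite /defect in du.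
have {}du m : [&& w m == take (size (w m)) (w m.+1),
        branching c (entry_z \o nth entry0 (w m.+1)) (size (w m.+1)) (size (w m))
      & all (valid_at c r (nth entry0 (w m.+1))) (iota 0 (size (w m.+1)))].
  by have := du m; rewrite !uw.
have ltw m : size (w m) < size (w m.+1) by have /and3P[_ /andP[]] := du m.
have gew m : m <= size (w m) by elim: m => // m /leq_ltn_trans; apply.
have [|d dw] := @chain_limit _ entry0 w ltw.
  by move=> m; have /and3P[/eqP] := du m.
have vd n : valid_at c r d n.
  have /and3P[_ _ /allP/(_ n)] := du n; rewrite mem_iota /= add0n => /(_ (gew n.+1)).
  by rewrite (@eq_valid_at _ _ _ d) // => k kn; rewrite dw // (leq_ltn_trans kn).
exists (entry_x \o d), (entry_y \o d), (entry_z \o d); split.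
- by move=> n; have /and3P[/implyP] := vd n.
- exists (entry_p \o d) => i j ij; have /and3P[_ /allP/(_ j) + _] := vd i.
  by rewrite mem_iota /= add0n => /(_ (proj1 (andP ij)))/implyP/(_ ij).
- exists (entry_q \o d) => i j ij; have /and3P[_ _ /allP/(_ j)] := vd i.
  by rewrite mem_iota /= add0n => /(_ (proj1 (andP ij)))/implyP/(_ ij).
- exists (size \o w) => m /=; have /and3P[_ + _] := du m.
  by rewrite (@eq_branching _ _ (entry_z \o d)) // => k kw; rewrite /= dw.
Qed.

(** * Comparability of well-founded trees *)

(** Comparison of the rank of [i] in [r] with that of [j] in [s], without
    ordinals. *)
Inductive rank_le (r s : nat -> nat -> bool) (i j : nat) : Prop :=
  RankLe : (forall i', r i' i -> exists j', s j' j /\ rank_le r s i' j') ->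
    rank_le r s i j.

(** If the comparison fails, some child [i'] of [i] is below no child of [j]; by induction every
    child of [j] is below this same [i']. *)
Lemma rank_le_total (r s : nat -> nat -> bool) i :
    Acc (fun a b => r a b) i ->
  forall j, rank_le r s i j \/ rank_le s r j i.
Proof.
elim=> {}i _ IHi j; have [le_ij|nle_ij] := EM (rank_le r s i j); [by left|right].
have [i' [ri'] nle] : exists i', r i' i /\ forall j', s j' j -> ~ rank_le r s i' j'.
  apply: contra_notP nle_ij => no; constructor => i' ri'.
  apply: contra_notP no => no'; exists i'; split => // j' sj' le'; apply: no'.
  by exists j'.
constructor => j' sj'; exists i'; split => //.
by case: (IHi _ ri' j') => // /(nle _ sj').
Qed.

Lemma not_illfounded_Acc (r : nat -> nat -> bool) :
  ~ illfounded r -> forall i, Acc (fun a b => r a b) i.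
Proof.
move=> wf i; apply: contra_notP wf => naci.
have /choice[f fP] j : exists k, ~ Acc (fun a b => r a b) j ->
    r k j /\ ~ Acc (fun a b => r a b) k.
  have [acj|nacj] := EM (Acc (fun a b => r a b) j); first by exists 0.
  have [k rk] : exists k, r k j /\ ~ Acc (fun a b => r a b) k.
    apply: contra_notP nacj => no; constructor => k rk.
    by apply: contra_notP no => nack; exists k.
  by exists k.
have nac m : ~ Acc (fun a b => r a b) (iter m f i) by elim: m => //= m /fP[].
by exists (fun m => iter m f i) => m; have [] := fP _ (nac m).
Qed.

Lemma rank_le_hom c x s :
  (forall i, exists j, rank_le (branching c x) s i j) -> hom (branching c x) s.
Proof.
set r := branching c x => /choice[top topP].
have /choice[ch chP] (ij : nat * nat) : exists j',
    r ij.1 (parent ij.1) -> rank_le r s (parent ij.1) ij.2 ->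
    s j' ij.2 /\ rank_le r s ij.1 j'.
  case: ij => i j /=.
  have [[ri [H]]|no] := EM (r i (parent i) /\ rank_le r s (parent i) j).
    by have [j' j'P] := H _ ri; exists j'.
  by exists 0 => ri le; case: no.
(* [n] is fuel: parents decrease, so any [n > i] gives the same value and the default 0 is never
   reached. Nodes without a parent start at [top]. *)
pose F := fix F (n i : nat) {struct n} : nat := if n is n'.+1 then
  if r i (parent i) then ch (i, F n' (parent i)) else top i else 0.
have rlt i j : r i j -> j < i /\ j = parent i by case/and3P => ? /eqP.
have FE n m i : i < n -> i < m -> F n i = F m i.
  elim: n m i => // n IHn [//|m] i ni mi /=; case: ifP => // /rlt[pi _].
  by rewrite (IHn m) ?(leq_trans pi).
have Frank n i : i < n -> rank_le r s i (F n i).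
  elim: n i => // n IHn i ni /=; case: ifP => // ri.
  have [pi _] := rlt _ _ ri.
  by apply: (chP (i, _) ri (IHn _ _)).2; exact: leq_trans pi _.
exists (fun i => F i.+1 i) => i j rij; have [ji jE] := rlt _ _ rij.
rewrite {j}jE in ji rij *; rewrite (FE (parent i).+1 i) // [F i.+1 i]/= rij.
exact: (chP (i, _) rij (Frank _ _ ji)).1.
Qed.

(** Uniqueness of parents is essential: no homomorphism exists either way
    between the order (nat, <) and a well-founded tree of rank omega + 1. *)
Lemma hom_total c x y : ~ illfounded (branching c x) ->
  hom (branching c x) (branching c y) \/ hom (branching c y) (branching c x).
Proof.
move=> /not_illfounded_Acc wfx.
have [le|nle] := EM (forall i, exists j, rank_le (branching c x) (branching c y) i j).
  by left; exact: rank_le_hom.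
right; apply: rank_le_hom => j.
have [i iP] : exists i, forall j, ~ rank_le (branching c x) (branching c y) i j.
  apply: contra_notP nle => no i; apply: contra_notP no => no'; exists i => k le.
  by apply: no'; exists k.
by exists i; case: (rank_le_total (branching c y) (wfx i) j) => // /iP.
Qed.

(** * The ideal extracted from a code *)

Definition good c x : Prop :=
  forall n, ~ illfounded (iter n (defect c) (branching c x)).

Lemma good_sub c (x y z : nat -> bool) : (forall n, z n -> x n || y n) ->
  hom (branching c y) (branching c x) -> good c x -> good c z.
Proof.
move=> zxy yx gx n; have := gx n.+1; apply: contra_not; apply: hom_illfounded.
rewrite iterSr; have : hom (branching c z) (defect c (branching c x)).
  by apply: hom_defect zxy _ yx; exact: hom_refl.
by elim: n => //= n IHn /IHn; exact: defect_hom.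
Qed.

Lemma good_union c (x y z : nat -> bool) : (forall n, z n -> x n || y n) ->
  good c x -> good c y -> good c z.
Proof.
move=> zxy gx gy; have [xy|yx] := hom_total y (gx 0).
  by apply: good_sub xy gy => n /zxy; rewrite orbC.
exact: good_sub zxy yx gx.
Qed.

(** Adding [set0] by hand keeps the family nonempty even when no set is good. *)
Definition derived_ideal c : set (set nat) :=
  [set A | A = set0 \/ good c (fun n => n \in A)].

Lemma derived_ideal_ideal c : ideal_on_omega (derived_ideal c).
Proof.
have sub A B : B `<=` A -> derived_ideal c A -> derived_ideal c B.
  move=> BA [A0|gA]; first by left; rewrite -subset0 -A0.
  by right; apply: (good_union _ gA gA) => n; rewrite orbb => /set_mem/BA/mem_set.
split; last by move=> A B; exact: sub.
  by exists set0; left.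
move=> A B [->|gA]; first by rewrite set0U.
move=> [->|gB]; first by rewrite setU0; right.
by right; apply: good_union gA gB => n; rewrite in_setU.
Qed.

Definition codes c (I : set (set nat)) : Prop :=
  forall x : nat -> bool, I [set n | x n] <-> ~ illfounded (branching c x).

Lemma codes_derived_ideal c I : ideal_on_omega I -> codes c I -> derived_ideal c = I.
Proof.
move=> [[A0 IA0] IU IS] cI.
(* A branch of the defect would give two members of [I] whose union includes a non-member. *)
have wfd r : ~ illfounded r -> ~ illfounded (defect c r).
  move=> wfr /defect_illfounded[x [y [z [zxy xr yr]]]]; apply/cI.
  apply: (IS ([set n | x n] `|` [set n | y n])); first by move=> n /zxy /orP.
  by apply: IU; apply/cI; apply: contra_not wfr; exact: hom_illfounded.
apply/seteqP; split => A.
  case=> [-> | /(_ 0)]; first exact: IS (sub0set _) IA0.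
  move=> /= /cI; congr I; apply/seteqP; split => n; by rewrite /= inE.
move=> IA; right; elim=> [|n IHn] /=; last exact: wfd.
apply/cI; move: IA; congr I; apply/seteqP; split => n; by rewrite /= inE.
Qed.

(** * Closed sets and codes for analytic sets *)

Definition locally_constant (T : topologicalType) V (F : T -> V) : Prop :=
  forall p, \forall q \near p, F q = F p.

Lemma lc_cst (T : topologicalType) V (v : V) : locally_constant (fun _ : T => v).
Proof. by move=> p; apply: nearW. Qed.

Lemma lc_bind (T : topologicalType) U V (G : T -> U) (F : U -> T -> V) :
  locally_constant G -> (forall u, locally_constant (F u)) ->
  locally_constant (fun p => F (G p) p).
Proof.
by move=> lG lF p; move: (lG p) (lF (G p) p); apply: filterS2 => q -> ->.
Qed.

Lemma lc_coord (K : discreteTopologicalType) (i : nat) :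
  locally_constant (fun f : {ptws nat -> K} => f i).
Proof.
move=> f; have := @proj_continuous nat (fun _ => K) i f [set x | x = f i].
by apply; rewrite nbhs_principalE.
Qed.
Lemma closed_locally_constant (T : topologicalType) (F : T -> bool) :
  locally_constant F -> closed [set p | F p].
Proof. by move=> lF p clp; have [q [/= Fq <-]] := clp _ (lF p). Qed.

Lemma closed_agree (C : set (cantor_space * baire_space)%type)
    (x : nat -> bool) (y : nat -> nat) :
    closed C ->
    (forall n, exists x' y', [/\ C (x', y'), forall i, i < n -> x' i = x i
                               & forall i, i < n -> y' i = y i]) ->
  C (x, y).
Proof.
move=> clC /choice[x' /choice[y' xy']].
pose u n : (cantor_space * baire_space)%type := (x' n, y' n).
suff uxy : u @ \oo --> ((x, y) : (cantor_space * baire_space)%type).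
  by apply: (closed_cvg C clC _ _ uxy); apply: nearW => n; case: (xy' n).
apply: (@cvg_pair nat cantor_space baire_space \oo (nbhs (x : cantor_space))
  (nbhs (y : baire_space)) _ _ _ x' y') => /=.
  apply/(@pointwise_cvgP nat bool) => i; apply/discrete_cvg.
  by exists i.+1 => // n /= lin; have [_ -> //] := xy' n.
apply/(@pointwise_cvgP nat nat) => i; apply/discrete_cvg.
by exists i.+1 => // n /= lin; have [_ _ ->] := xy' n.
Qed.

(** A node codes a reversed initial segment of [y], so [parent] drops the last value. It survives if
    some point of [C] agrees with [x] and [y] so far; closedness of [C] handles the limit. *)
Lemma Sigma11_code (S : set cantor_space) : Sigma11 S ->
  exists c : nat -> bool, forall x, S x <-> illfounded (branching c x).
Proof.
move=> [C clC ->].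
pose Q (w : seq bool) i := exists (x' : nat -> bool) (y' : nat -> nat),
  [/\ C (x', y'), mkseq x' i = w &
      rev (mkseq y' (size (CodeSeq.decode i))) = CodeSeq.decode i].
pose c k := if (unpickle k : option (seq bool * nat)%type) is Some (w, i)
  then `[< Q w i >] else false.
have cE w i : c (pickle (w, i)) = `[< Q w i >] by rewrite /c pickleK.
exists c => x; split => [[[x' y] /= Cxy <-]|[u bu]].
  exists (fun m => CodeSeq.code (rev (mkseq y m))) => m.
  have -> : rev (mkseq y m.+1) = y m :: rev (mkseq y m).
    by rewrite /mkseq -[in LHS]addn1 iotaD map_cat rev_cat.
  rewrite /branching code_cons_gt /parent CodeSeq.codeK eqxx cE.
  apply/asboolP; exists x', y; split => //.
  by rewrite CodeSeq.codeK /= size_rev size_mkseq /mkseq -addn1 iotaD map_cat rev_cat.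
pose D m := CodeSeq.decode (u m).
(* The strict inequality in [branching] rules out the empty sequence, which is its own parent. *)
have DS m : exists v, D m.+1 = v :: D m.
  have /and3P[lt /eqP uE _] := bu m.
  move: lt; rewrite {2}/D uE /parent CodeSeq.codeK /D -{2}[u m.+1]CodeSeq.decodeK.
  by case: CodeSeq.decode => // v s _; exists v.
have [||y yP] := @chain_limit _ 0 (rev \o D).
- by move=> m /=; have [v ->] := DS m; rewrite !size_rev.
- by move=> m /=; have [v ->] := DS m; rewrite rev_cons -cats1 take_size_cat.
have geu m : m <= u m by elim: m => // m /leq_ltn_trans; apply; case/and3P: (bu m).
have geD m : m <= size (D m).
  by elim: m => // m IHm; have [v ->] := DS m.
exists (x, y) => //; apply: closed_agree clC _ => n.
have /and3P[_ _] := bu n; rewrite cE => /asboolP[x' [y' [Cxy xx' yD]]].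
exists x', y'; split => // i ni.
  have iu : i < u n.+1 by rewrite (leq_trans ni) // ltnW.
  by rewrite -(nth_mkseq false x' iu) xx' nth_mkseq.
have iD : i < size (D n.+1) by rewrite (leq_trans ni) // ltnW.
rewrite -(yP n.+1) /= ?size_rev //; move: iD; rewrite /D => iD.
by rewrite -yD revK nth_mkseq.
Qed.

(** * Gluing along the branches of the binary tree *)

Definition level (m : nat) : nat := head 0 (CodeSeq.decode m).

Lemma level_unbounded n k : exists m, k <= m /\ level m = n.
Proof.
exists (CodeSeq.code (n :: CodeSeq.decode k)); rewrite /level CodeSeq.codeK.
by split => //; rewrite ltnW // -{1}[k]CodeSeq.decodeK code_cons_gt.
Qed.

Definition node (c : nat -> bool) (m : nat) : nat := pickle (mkseq c m).

(** The length of a node determines its label, so one map serves as the reduction for every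
    branch. *)
Definition node_level (k : nat) : nat :=
  level (size (odflt [::] (unpickle k : option (seq bool)))).

Lemma node_levelE c m : node_level (node c m) = level m.
Proof. by rewrite /node_level /node pickleK /= size_mkseq. Qed.

Lemma node_inj c c' m m' : node c m = node c' m' ->
  m = m' /\ forall k, k < m -> c k = c' k.
Proof.
move=> /(pcan_inj pickleK) E.
have mm' : m = m' by rewrite -(size_mkseq c m) E size_mkseq.
split => // k km; rewrite -(nth_mkseq false c km) E nth_mkseq //.
by rewrite -mm'.
Qed.

Definition trace (c : nat -> bool) (X : set nat) : set nat :=
  [set n | forall k, exists m, [/\ k <= m, level m = n & X (node c m)]].

Definition universal_ideal : set (set nat) :=
  [set X | forall c, derived_ideal c (trace c X)].

Lemma universal_ideal_ideal : ideal_on_omega universal_ideal.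
Proof.
split.
- exists set0 => c; left; rewrite -subset0 => n /(_ 0)[m []] //.
- move=> X Y IX IY c; have [_ IU IS] := derived_ideal_ideal c.
  apply: IS (IU _ _ (IX c) (IY c)) => n nXY.
  apply: contrapT => /not_orP[/existsNP[k kX] /existsNP[l lY]].
  have [m [klm mn]] := nXY (maxn k l).
  move: klm; rewrite geq_max => /andP[km lm].
  by case=> [Xm|Ym]; [apply: kX | apply: lY]; exists m.
- move=> X Y YX IX c; have [_ _ IS] := derived_ideal_ideal c.
  apply: IS (IX c) => n nY k; have [m [km mn Ym]] := nY k.
  by exists m; split => //; exact: YX.
Qed.

(** Distinct branches share only the nodes up to their first difference, so no label recurs along
    [c']. *)
Lemma trace_node c c' (x : set nat) :
  trace c' (range (node c) `&` node_level @^-1` x) = if `[< c' = c >] then x else set0.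
Proof.
case: asboolP => [->|c'c].
  apply/seteqP; split => n.
    by move=> /(_ 0)[m [_ <- [_]]]; rewrite /= node_levelE.
  move=> xn k; have [m [km mn]] := level_unbounded n k; exists m; split => //.
  by split; [exists m | rewrite /= node_levelE mn].
rewrite -subset0 => n nX; apply: c'c; apply/funext => k.
by have [m [km _ [[m' _ /esym/node_inj[_ ck]] _]]] := nX k.+1; exact: ck.
Qed.

Lemma wRK_le_universal_ideal I : Pi11_ideal I -> wRK_le I universal_ideal.
Proof.
move=> [idI /Sigma11_code[c cI]].
have codI : codes c I.
  move=> x; split => [Ix /cI|nwf]; first exact.
  by apply: contrapT => nI; apply/nwf/cI.
have dE := codes_derived_ideal idI codI.
exists (range (node c)), node_level; split.
  have := @inj_card_eq _ _ setT (node c) (in2W (fun m m' E => (node_inj E).1)).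
  by rewrite card_eq_le infiniteP => /andP[].
move=> x; split => [Ix c'|/(_ c)]; rewrite trace_node.
  by case: asboolP => [->|_]; [rewrite dE | left].
by rewrite asboolT // dE.
Qed.

(** * The glued ideal is co-analytic *)

Section LocallyConstant.
Variable T : topologicalType.

Lemma lc_comp (T' : topologicalType) V (g : T -> T') (F : T' -> V) :
  continuous g -> locally_constant F -> locally_constant (F \o g).
Proof. by move=> cg lF p; exact: (cg p _ (lF (g p))). Qed.

Lemma lc_app U V (h : U -> V) (F : T -> U) :
  locally_constant F -> locally_constant (fun p => h (F p)).
Proof.
by move=> lF; apply: (lc_bind (F := fun u _ => h u) lF) => u; exact: lc_cst.
Qed.

Lemma lc_app2 U U' V (h : U -> U' -> V) (F : T -> U) (G : T -> U') :
  locally_constant F -> locally_constant G -> locally_constant (fun p => h (F p) (G p)).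
Proof.
move=> lF lG; apply: (lc_bind (F := fun u p => h u (G p)) lF) => u.
exact: lc_app.
Qed.

Lemma lc_map (I : Type) V (F : T -> I -> V) (s : seq I) :
  (forall i, locally_constant (F^~ i)) -> locally_constant (fun p => map (F p) s).
Proof.
by move=> lF; elim: s => [|i s IHs] /=; [exact: lc_cst | exact: lc_app2].
Qed.

Lemma lc_all (I : Type) (F : T -> I -> bool) (s : seq I) :
  (forall i, locally_constant (F^~ i)) -> locally_constant (fun p => all (F p) s).
Proof.
by move=> lF; elim: s => [|i s IHs] /=; [exact: lc_cst | exact: lc_app2].
Qed.

Lemma lc_branching (c x : T -> nat -> bool) i j :
  (forall k, locally_constant (c^~ k)) -> (forall k, locally_constant (x^~ k)) ->
  locally_constant (fun p => branching (c p) (x p) i j).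
Proof.
move=> lc_c lc_x; do 2![apply: lc_app2; first exact: lc_cst].
apply: (lc_bind (G := fun p => mkseq (x p) i)
  (F := fun s p => c p (pickle (s, i)))) => //.
exact: lc_map.
Qed.

Lemma lc_defect (c : T -> nat -> bool) (r : T -> nat -> nat -> bool) k' k :
  (forall k, locally_constant (c^~ k)) ->
  (forall i j, locally_constant (fun p => r p i j)) ->
  locally_constant (fun p => defect (c p) (r p) k' k).
Proof.
move=> lc_c lc_r; rewrite /defect.
case: (attempt k') => [w'|]; last exact: lc_cst.
case: (attempt k) => [w|]; last exact: lc_cst.
apply: lc_app2; first exact: lc_cst.
apply: lc_app2; first by apply: lc_branching => // i; exact: lc_cst.
apply: lc_all => n; apply: lc_app2; first exact: lc_cst.
by apply: lc_app2; apply: lc_all => b; apply: lc_app2 => //;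
  apply: lc_branching => // i; exact: lc_cst.
Qed.

(** The indices vary with [p] because [witness] reads them off the point itself. *)
Lemma lc_iter_defect (c x : T -> nat -> bool) (n k' k : T -> nat) :
  (forall i, locally_constant (c^~ i)) -> (forall i, locally_constant (x^~ i)) ->
  locally_constant n -> locally_constant k' -> locally_constant k ->
  locally_constant (fun p =>
    iter (n p) (defect (c p)) (branching (c p) (x p)) (k' p) (k p)).
Proof.
move=> lc_c lc_x lc_n lc_k' lc_k.
pose D n k' k p := iter n (defect (c p)) (branching (c p) (x p)) k' k.
apply: (lc_bind (F := fun n p => D n (k' p) (k p) p) lc_n) => {lc_n}n.
apply: (lc_bind (F := fun k' p => D n k' (k p) p) lc_k') => {lc_k'}k'.
apply: (lc_bind (F := fun k p => D n k' k p) lc_k) => {lc_k}k.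
rewrite /D; elim: n k' k => [|n IHn] k' k /=; first exact: lc_branching.
exact: lc_defect.
Qed.

End LocallyConstant.

Local Notation plane := (cantor_space * baire_space)%type.

Definition comp_at (y : nat -> nat) (t i j : nat) : nat := y (pickle (t, (i, j))).

Lemma comp_at_surj (F : nat -> nat -> nat -> nat) :
  exists y, forall t i j, comp_at y t i j = F t i j.
Proof.
exists (fun k => if (unpickle k : option (nat * (nat * nat))%type) is Some (t, (i, j))
  then F t i j else 0) => t i j.
by rewrite /comp_at pickleK.
Qed.

Section witness.
Variable p : plane.

Let c (i : nat) : bool := 0 < comp_at p.2 0 i 0.
Let x (i : nat) : bool := 0 < comp_at p.2 1 i 0.
Let u (m : nat) : nat := comp_at p.2 2 m 0.
Let v (n k : nat) : nat := comp_at p.2 3 n k.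
Let e : nat := comp_at p.2 4 0 0.
Let N : nat := comp_at p.2 4 1 0.

(** x is a set of labels occurring infinitely often along the branch c (as
    witnessed by v), nonempty (as witnessed by e), and u is a descending
    sequence in the N-th iterate for x. *)
Definition witness (n k : nat) : bool :=
  [&& x e,
      iter N (defect c) (branching c x) (u n.+1) (u n)
    & x n ==> [&& k <= v n k, level (v n k) == n & p.1 (node c (v n k))]].

End witness.

Lemma lc_witness n k : locally_constant (fun p => witness p n k).
Proof.
have lc2 t i j : locally_constant (fun p : plane => comp_at p.2 t i j).
  apply: (lc_comp (g := snd) (F := fun y : baire_space => comp_at y t i j)).
    by move=> p; exact: cvg_snd.
  exact: lc_coord.
have lc1 i : locally_constant (fun p : plane => p.1 i).
  apply: (lc_comp (g := fst) (F := fun a : cantor_space => a i)).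
    by move=> p; exact: cvg_fst.
  exact: lc_coord.
have lcb t i : locally_constant (fun p : plane => 0 < comp_at p.2 t i 0).
  exact: (lc_app (fun m => 0 < m)).
apply: lc_app2.
  by apply: (lc_bind (F := fun i (p : plane) => 0 < comp_at p.2 1 i 0)).
apply: lc_app2; first by apply: lc_iter_defect.
apply: lc_app2 => //.
apply: (lc_bind (F := fun m (p : plane) =>
  [&& k <= m, level m == n & p.1 (node (fun i => 0 < comp_at p.2 0 i 0) m)])) => // m.
do 2![apply: lc_app2; first exact: lc_cst].
apply: (lc_bind (F := fun i (p : plane) => p.1 i)) => //.
by apply: lc_app; apply: lc_map.
Qed.

(** Non-membership is witnessed by a single [y] packing all the data, subject to countably many
    clopen conditions. *)
Lemma universal_ideal_Pi11 : Pi11 (cantor_set universal_ideal).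
Proof.
exists [set p | forall nk : nat * nat, witness p nk.1 nk.2].
  rewrite (_ : [set p | _] = \bigcap_nk [set p | witness p nk.1 nk.2]).
    by apply: closed_bigI => nk _; apply: closed_locally_constant; exact: lc_witness.
  by apply/seteqP; split => p wp nk; [move=> _|]; exact: wp.
apply/seteqP; split => a.
  move=> /existsNP[c /not_orP[/eqP/set0P[e eX] /existsNP[N /contrapT[u uP]]]].
  set X := trace c _ in eX uP.
  have /choice[v vP] (nk : nat * nat) : exists m, X nk.1 ->
      [/\ nk.2 <= m, level m = nk.1 & a (node c m)].
    have [Xn|nXn] := EM (X nk.1); last by exists 0.
    by have [m mP] := Xn nk.2; exists m.
  have [y yE] := comp_at_surj (fun t i j => match t with
    | 0 => c i : nat | 1 => (i \in X) : nat | 2 => u i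
    | 3 => v (i, j) | _ => if i is 0 then e else N end).
  exists (a, y) => // -[n k] /=; rewrite /witness /= !yE.
  have cE : (fun i => 0 < comp_at y 0 i 0) = c.
    by apply/funext => i; rewrite yE lt0b.
  have xE : (fun i => 0 < comp_at y 1 i 0) = (fun i => i \in X).
    by apply/funext => i; rewrite yE lt0b.
  rewrite cE xE !lt0b mem_set //= uP /=.
  apply/implyP => /set_mem/(vP (n, k))[/= -> /eqP -> ->]; done.
move=> [[a' y] /= wp <-{a}] /= IX.
pose c i := 0 < comp_at y 0 i 0; pose x i := 0 < comp_at y 1 i 0.
have [_ _ sub] := derived_ideal_ideal c.
(* The witnessed set is only included in the trace; downward closure bridges the gap. *)
have: derived_ideal c [set n | x n].
  apply: sub (IX c) => n xn k; exists (comp_at y 3 n k).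
  by have /and3P[_ _ /implyP/(_ xn)/and3P[? /eqP ? ?]] := wp (n, k).
case=> [x0|].
  have /and3P[xe _ _] := wp (0, 0).
  suff : [set n | x n] (comp_at y 4 0 0) by rewrite x0.
  exact: xe.
move=> /(_ (comp_at y 4 1 0)); apply; exists (fun m => comp_at y 2 m 0) => m.
have /and3P[_ + _] := wp (m, 0); congr (is_true (iter _ _ (branching _ _) _ _)).
by apply/funext => n; apply/idP/idP; rewrite inE.
Qed.

Theorem theorem1p4 :
  exists J : set (set nat), wRK_complete Pi11_ideal J.
Proof.
exists universal_ideal; split.
  split; [exact: universal_ideal_ideal | exact: universal_ideal_Pi11].
exact: wRK_le_universal_ideal.
Qed.
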